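(* Let $E$ be an arbitrary (countable, not necessarily row-finite) directed graph and $F$ any desingularization of $E$. Then: (1) $P_l(E)=P_l(F)\cap E^0$. (2) $P_l(E)\neq\emptyset$ if and only if $P_l(F)\neq\emptyset$.
   Context: A graph $E=(E^0,E^1,r,s)$ consists of countable sets $E^0$ (vertices), $E^1$ (edges) and maps $r,s:E^1\to E^0$ (range, source). A vertex $v$ is a sink if $s^{-1}(v)=\emptyset$ and an infinite emitter if $s^{-1}(v)$ is infinite. A path is a vertex (length $0$) or a sequence $\mu=e_1\cdots e_n$ of edges with $r(e_i)=s(e_{i+1})$; $s(\mu)=s(e_1)$, $r(\mu)=r(e_n)$. A cycle is a path $e_1\cdots e_n$ ($n\ge1$) with $s(e_1)=r(e_n)$ and $s(e_i)\neq s(e_j)$ for $i\ne j$. $T(v)$ is the set of vertices $w$ such that there is a path from $v$ to $w$ (length $0$ allowed). A vertex $v$ is a bifurcation if $|s^{-1}(v)|\ge 2$. A vertex $u$ of a graph $G$ is a line point if there are neither bifurcations nor cycles at any vertex $w\in T(u)$; $P_l(G)$ is the set of line points of $G$. Desingularization: if $v_0$ is a sink of $E$, adding a tail at $v_0$ means adding new vertices $v_1,v_2,\dots$ and new edges $v_{i-1}\to v_{i}$ ($i\ge1$). If $v_0$ is an infinite emitter, adding a tail at $v_0$ means: list the edges of $s^{-1}(v_0)$ as $e_1,e_2,e_3,\dots$; add new vertices $v_1,v_2,\dots$ and new edges $f_i$ from $v_{i-1}$ to $v_i$ ($i\ge 1$); remove all edges of $s^{-1}(v_0)$, and for each $j\ge1$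 add an edge $g_j$ from $v_{j-1}$ to $r(e_j)$. A desingularization of $E$ is a graph $F$ obtained by adding a tail at every sink and every infinite emitter of $E$ in this way (with distinct new vertices and edges for distinct tails); thus $E^0\subseteq F^0$. *)

(* Defs.v *)
From mathcomp Require Import all_boot all_classical.

Set Implicit Arguments.
Unset Strict Implicit.
Unset Printing Implicit Defensive.

Local Open Scope classical_set_scope.

(* The vertices and edges of a graph are subsets of ambient types V and A, so
   that one graph can literally contain vertices and edges of another one.
   The values of src and rng outside of edges are irrelevant. *)
Record graph (V A : choiceType) := Graph {
  vertices : set V;
  edges : set A;
  src : A -> V;
  rng : A -> V;
  src_vertex : forall e, edges e -> vertices (src e);
  rng_vertex : forall e, edges e -> vertices (rng e);
  countable_vertices : countable vertices;
  countable_edges : countable edges }.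

Section Graph.
Variables (V A : choiceType).
Implicit Types (G : graph V A) (v w : V) (p : seq A).

Definition emitted G v : set A := [set e | edges G e /\ src G e = v].

Definition sink G v : Prop := vertices G v /\ emitted G v = set0.

Definition infinite_emitter G v : Prop :=
  vertices G v /\ infinite_set (emitted G v).

Definition bifurcation G v : Prop := vertices G v /\ (`I_2 #<= emitted G v)%card.

(* The empty sequence stands for the path of length 0 at v. *)
Fixpoint is_path G v p w : Prop :=
  if p is e :: p' then [/\ edges G e, src G e = v & is_path G (rng G e) p' w]
  else vertices G v /\ v = w.

Definition tree G v : set V := [set w | exists p, is_path G v p w].

Definition is_cycle_at G w p : Prop :=
  [/\ p <> [::], is_path G w p w & uniq [seq src G e | e <- p]].

Definition line_points G : set V :=
  [set u | vertices G u /\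
     forall w, tree G u w ->
       ~ bifurcation G w /\ ~ (exists p, is_cycle_at G w p)].

Definition singular G v : Prop := sink G v \/ infinite_emitter G v.

(* For v singular, [t v i] is the vertex v_i of the tail added at v = v_0.
   Edges are numbered from 0: [f v i] goes from v_i to v_(i+1) and, if v is an
   infinite emitter, [l v] lists without repetition the edges of E emitted by v,
   the edge [l v j] being replaced by [g v j], from v_j to its range.  The values
   of t and f at non-singular vertices, and of l and g at vertices that are not
   infinite emitters, are irrelevant. *)
Record desingularization_by (E F : graph V A)
    (t : V -> nat -> V) (f l g : V -> nat -> A) : Prop := {
  tail0 : forall v, singular E v -> t v 0 = v;
  tail_new : forall v i, singular E v -> ~ vertices E (t v i.+1);
  tail_inj : forall v w i j, singular E v -> singular E w ->
    t v i.+1 = t w j.+1 -> v = w /\ i = j;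
  listing : forall v, infinite_emitter E v ->
    set_bij [set: nat] (emitted E v) (l v);
  f_new : forall v i, singular E v -> ~ edges E (f v i);
  g_new : forall v j, infinite_emitter E v -> ~ edges E (g v j);
  f_inj : forall v w i j, singular E v -> singular E w ->
    f v i = f w j -> v = w /\ i = j;
  g_inj : forall v w i j, infinite_emitter E v -> infinite_emitter E w ->
    g v i = g w j -> v = w /\ i = j;
  f_neq_g : forall v w i j, singular E v -> infinite_emitter E w ->
    f v i <> g w j;
  desing_vertices : vertices F =
    vertices E `|` [set t v i.+1 | v in singular E & i in [set: nat]];
  desing_edges : edges F =
    [set e | edges E e /\ ~ infinite_emitter E (src E e)]
    `|` [set f v i | v in singular E & i in [set: nat]]
    `|` [set g v j | v in infinite_emitter E & j in [set: nat]];
  kept_edge : forall e, edges E e -> ~ infinite_emitter E (src E e) ->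
    src F e = src E e /\ rng F e = rng E e;
  f_edge : forall v i, singular E v ->
    src F (f v i) = t v i /\ rng F (f v i) = t v i.+1;
  g_edge : forall v j, infinite_emitter E v ->
    src F (g v j) = t v j /\ rng F (g v j) = rng E (l v j) }.

Definition desingularization (E F : graph V A) : Prop :=
  exists t f l g, desingularization_by E F t f l g.

End Graph.

(* Main.v *)
Require Import Defs.
From mathcomp Require Import all_boot all_classical.

Set Implicit Arguments.
Unset Strict Implicit.
Unset Printing Implicit Defensive.

Local Open Scope classical_set_scope.

(* Both inclusions of (1) transfer paths edge by edge.  A line point of E
   reaches no infinite emitter of E (a bifurcation), so an F-path from it either
   is an E-path or has entered the tail of a sink, which it can neither leave nor
   cycle in.  Conversely, each vertex of the tail of an infinite emitter is a
   bifurcation of F, so a line point of F reaches no infinite emitter of E, and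
   the E-paths starting there are F-paths.  For the same reason a line point of
   F outside E lies on the tail of a sink, and this sink is a line point of E. *)

Lemma card_le2_pair (T : Type) (X : set T) (x y : T) :
  X x -> X y -> x <> y -> (`I_2 #<= X)%card.
Proof.
move=> Xx Xy xy; pose h n := if n is 0 then x else y.
have h_inj : {in `I_2 &, injective h}.
  by move=> [|[|i]] [|[|j]]; rewrite !inE //= => _ _ // /esym.
have /card_eqPle[_ /card_le_trans] := inj_card_eq h_inj; apply.
by apply: subset_card_le => _ [[|i] _ <-].
Qed.

Lemma card_le2_subset1 (T : Type) (X : set T) (x : T) :
  X `<=` [set x] -> ~ (`I_2 #<= X)%card.
Proof.
move=> /subset_card_le Xx /card_le_trans/(_ Xx).
by rewrite (card_le_eqr card_set1) card_le_II.
Qed.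

(** * Paths and line points of a single graph *)

Section Paths.
Variables (V A : choiceType) (G : graph V A).

Lemma is_path_range v p w : is_path G v p w -> vertices G w.
Proof. by elim: p v => [v [Gv <-]|e p IHp v [_ _ /IHp]]. Qed.

Lemma is_path_cat u v w p q :
  is_path G u p v -> is_path G v q w -> is_path G u (p ++ q) w.
Proof. by elim: p u => [u [_ ->]|e p IHp u [Ge su /IHp pw] /pw]. Qed.

Lemma tree_refl v : vertices G v -> tree G v v.
Proof. by exists [::]. Qed.

Lemma line_points_tree u w : line_points G u -> tree G u w -> line_points G w.
Proof.
move=> [_ Lu] [p uw]; split; first exact: is_path_range uw.
by move=> x [q wx]; apply: Lu; exists (p ++ q); apply: is_path_cat uw wx.
Qed.

(** The form needed in inductions along a path, whose step goes from the source of an edge to its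
    range. *)
Lemma line_points_rng e :
  edges G e -> line_points G (src G e) -> line_points G (rng G e).
Proof.
move=> Ge /line_points_tree; apply; exists [:: e]; split=> //.
by split=> //; apply: rng_vertex.
Qed.

Lemma line_points_bifurcation u : line_points G u -> ~ bifurcation G u.
Proof. by move=> [Gu /(_ u (tree_refl Gu))[]]. Qed.

Lemma infinite_emitter_bifurcation v : infinite_emitter G v -> bifurcation G v.
Proof.
move=> [Gv /infiniteP infv]; split=> //.
by apply: card_le_trans infv; apply: subset_card_le.
Qed.

Lemma sink_line_point v : sink G v -> line_points G v.
Proof.
move=> [Gv Ev].
have stay p w : is_path G v p w -> p = [::] /\ v = w.
  case: p => [[]//|e p [Ge se _]].
  by have : emitted G v e by []; rewrite Ev.
split=> // w [p /stay[_ <-]]; split.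
  (* The empty set is bounded by [I_0], so that [card_le_II] reduces the claim to the failure of 2
     <= 0. *)
  move=> [_]; rewrite Ev => /card_le_trans/(_ (card_ge0 _ `I_0)).
  by rewrite card_le_II.
by case=> q [q0 /stay[]].
Qed.

End Paths.

(** * Vertices and edges of a desingularization *)

Section Desingularization.
Variables (V A : choiceType) (E F : graph V A).
Variables (t : V -> nat -> V) (f l g : V -> nat -> A).
Hypothesis D : desingularization_by E F t f l g.

Lemma vertices_desing v : vertices E v -> vertices F v.
Proof. by rewrite (desing_vertices D); left. Qed.

Lemma tail_eq_vertex v k w :
  singular E v -> vertices E w -> t v k = w -> v = w /\ k = 0.
Proof.
case: k => [|k] sv Ew; first by rewrite (tail0 D).
by move=> tw; case: (tail_new D (i := k) sv); rewrite tw.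
Qed.

Lemma singular_vertex v : singular E v -> vertices E v.
Proof. by case=> -[]. Qed.

(** Extends [tail_inj] to index 0: there the tail vertex lies in [E], whereas those of positive
    index are new. *)
Lemma tail_eq v w i j :
  singular E v -> singular E w -> t v i = t w j -> v = w /\ i = j.
Proof.
case: j => [|j] sv sw.
  by rewrite (tail0 D sw) => /(tail_eq_vertex sv (singular_vertex sw)).
case: i => [|i]; last by move=> /(tail_inj D sv sw)[-> ->].
rewrite (tail0 D sv) => /esym /(tail_eq_vertex sw (singular_vertex sv)).
by case.
Qed.

Lemma sink_not_infinite_emitter v : sink E v -> ~ infinite_emitter E v.
Proof. by move=> [_ Ev] [_]; rewrite Ev; apply; apply: finite_set0. Qed.

Lemma tail_vertex v k : singular E v -> vertices F (t v k).
Proof.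
rewrite (desing_vertices D) => sv; case: k => [|k].
  by left; rewrite (tail0 D sv); apply: singular_vertex.
by right; exists v => //; exists k.
Qed.

Lemma emitted_f v k : singular E v -> emitted F (t v k) (f v k).
Proof.
move=> sv; split; last by case: (f_edge D k sv).
by rewrite (desing_edges D); left; right; exists v => //; exists k.
Qed.

Lemma infinite_emitter_tail_bifurcation v k :
  infinite_emitter E v -> bifurcation F (t v k).
Proof.
move=> iv; have sv : singular E v by right.
split; first exact: tail_vertex.
(* The second edge leaving [t v k] is [g v k], which replaces the listed edge [l v k]. *)
apply: card_le2_pair (emitted_f k sv) _ (f_neq_g D (j := k) sv iv).
split; last by case: (g_edge D k iv).
by rewrite (desing_edges D); right; exists v => //; exists k.
Qed.

(** A kept edge starts in [E], so it could only start at [t v 0 = v], which emits nothing in [E]; an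
    edge [g w i] starts on the tail of an infinite emitter, and distinct tails are disjoint. *)
Lemma emitted_sink_tail v k : sink E v -> emitted F (t v k) `<=` [set f v k].
Proof.
move=> kv e []; have sv : singular E v by left.
rewrite (desing_edges D) => -[[[Ee ie]|[w sw [i _ <-]]]|[w iw [i _ <-]]].
- case: (kept_edge D Ee ie) => -> _ /esym.
  move=> /(tail_eq_vertex sv (src_vertex Ee)) [vE _].
  have : emitted E v e by split.
  by case: kv => _ ->.
- by case: (f_edge D i sw) => -> _ /(tail_eq sw sv)[-> ->].
- have sw : singular E w by right.
  case: (g_edge D i iw) => -> _ /(tail_eq sw sv)[wv _].
  by case: (sink_not_infinite_emitter kv); rewrite -wv.
Qed.

(** The only tail edge that starts in [E] is the first one, and here the root of its tail can only
    be a sink. *)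
Lemma emitted_vertex v e :
  vertices E v -> ~ infinite_emitter E v -> emitted F v e ->
  [/\ emitted E v e, src F e = src E e & rng F e = rng E e] \/
  sink E v /\ e = f v 0.
Proof.
move=> Ev iv []; rewrite (desing_edges D).
move=> [[[Ee ie]|[w sw [i _ <-]]]|[w iw [i _ <-]]].
- case: (kept_edge D Ee ie) => se re sv; left.
  by split=> //; split=> //; rewrite -se.
- case: (f_edge D i sw) => -> _ /(tail_eq_vertex sw Ev)[wv i0].
  by subst i w; right; split=> //; case: sw.
- case: (g_edge D i iw) => -> _ /(tail_eq_vertex (or_intror iw) Ev)[wv _].
  by subst w.
Qed.

Lemma edge_desing e :
  edges E e -> ~ infinite_emitter E (src E e) -> edges F e.
Proof. by move=> Ee ie; rewrite (desing_edges D); left; left. Qed.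

Lemma sink_tail_path v k p w :
  sink E v -> is_path F (t v k) p w -> w = t v (k + size p).
Proof.
move=> kv; elim: p k => [k [_ <-]|e p IHp k [Fe se]]; first by rewrite addn0.
have -> : e = f v k by apply: (emitted_sink_tail kv).
case: (f_edge D k (or_introl kv)) => _ -> /IHp ->.
by rewrite addSnnS.
Qed.

(** * Comparison of paths and line points in [E] and [F] *)

Lemma line_points_not_infinite_emitter u :
  line_points E u -> ~ infinite_emitter E u.
Proof. by move=> /line_points_bifurcation Lu /infinite_emitter_bifurcation. Qed.

Lemma line_points_desing_not_infinite_emitter u k :
  line_points F (t u k) -> ~ infinite_emitter E u.
Proof.
by move=> /line_points_bifurcation Lu /(infinite_emitter_tail_bifurcation k).
Qed.

Lemma line_points_desing_vertex_not_infinite_emitter u :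
  line_points F u -> ~ infinite_emitter E u.
Proof.
move=> Lu iu; apply: (@line_points_desing_not_infinite_emitter u 0 _ iu).
by rewrite (tail0 D (or_intror iu)).
Qed.

(** The equality of source sequences is carried along because [is_cycle_at] requires distinct
    sources, computed with [src F] in one graph and [src E] in the other. *)
Lemma path_from_line_point u p w : line_points E u -> is_path F u p w ->
  (is_path E u p w /\ [seq src F e | e <- p] = [seq src E e | e <- p]) \/
  exists v k, sink E v /\ w = t v k.+1.
Proof.
elim: p u => [u Lu [_ <-]|e p IHp u Lu [Fe su pw]].
  by left; split=> //; split=> //; case: Lu.
have iu := line_points_not_infinite_emitter Lu.
have [[[Ee sE] sF rF]|[ku ef]] := emitted_vertex (proj1 Lu) iu (conj Fe su).
  rewrite rF in pw.
  have /IHp/(_ pw)[[pE eqs]|] : line_points E (rng E e).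
    by apply: line_points_rng; rewrite ?sE.
    by left; split; [split | rewrite /= sF eqs].
  by right.
move: pw; rewrite ef; case: (f_edge D 0 (or_introl ku)) => _ ->.
by move=> /(sink_tail_path ku) ->; right; exists u, (size p); rewrite add1n.
Qed.

Lemma path_desing u p w : line_points F u -> is_path E u p w ->
  is_path F u p w /\ [seq src F e | e <- p] = [seq src E e | e <- p].
Proof.
elim: p u => [u [Fu _] [_ <-]|e p IHp u Lu [Ee su pw]] //.
have iu := line_points_desing_vertex_not_infinite_emitter Lu.
rewrite -su in iu; have [sF rF] := kept_edge D Ee iu.
have Fe := edge_desing Ee iu.
have /IHp/(_ pw)[pF eqs] : line_points F (rng E e).
  by rewrite -rF; apply: line_points_rng; rewrite ?sF ?su.
by rewrite /= eqs sF rF.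
Qed.

Lemma line_points_sub_desing u : line_points E u -> line_points F u.
Proof.
move=> Lu; split; first by apply: vertices_desing; case: Lu.
have tail_ok v k : sink E v ->
    ~ bifurcation F (t v k) /\ ~ exists p, is_cycle_at F (t v k) p.
  move=> kv; split; first by case=> _; apply/card_le2_subset1/emitted_sink_tail.
  move=> [p [p0 /(sink_tail_path kv)]].
  move=> /(tail_eq (or_introl kv) (or_introl kv))[_].
  (* A cycle [p] at [t v k] would give [k = k + size p] with [p] nonempty. *)
  by case: p p0 => //= e p _ /eqP; rewrite -{1}[k]addn0 eqn_add2l.
move=> w [p /(path_from_line_point Lu)]; case; last first.
  by move=> [v [k [kv ->]]]; apply: tail_ok.
move=> [pE _]; have Lw : line_points E w.
  by apply: line_points_tree Lu _; exists p.
have Ew := proj1 Lw; have iw := line_points_not_infinite_emitter Lw.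
(* A sink of [E] is treated as vertex 0 of its own tail, since in [F] it emits [f w 0]; any other
   [w] reached here emits in [F] only edges that it emits in [E]. *)
have [kw|nkw] := EM (sink E w).
  by rewrite -(tail0 D (or_introl kw)); apply: tail_ok.
split.
  move=> [_ bw]; apply: (line_points_bifurcation Lw); split=> //.
  apply: card_le_trans bw _; apply: subset_card_le => e.
  by move=> /(emitted_vertex Ew iw)[[]|[]].
move=> [q [q0 qF]]; case: (path_from_line_point Lw qF) => [[qE ->] uq|].
  by case: Lw => _ /(_ w (tree_refl Ew))[_]; apply; exists q.
(* The path cannot end on a new tail vertex, because it returns to [w], a vertex of [E]. *)
move=> [v [k [kv wt]]]; case: (tail_new D (i := k) (or_introl kv)).
by rewrite -wt.
Qed.

Lemma line_points_desing_sub u :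
  line_points F u -> vertices E u -> line_points E u.
Proof.
move=> Lu Eu; split=> // w [p pE].
have [pF _] := path_desing Lu pE.
have Lw : line_points F w by apply: line_points_tree Lu _; exists p.
have iw := line_points_desing_vertex_not_infinite_emitter Lw.
split.
  move=> [_ bw]; apply: (line_points_bifurcation Lw); split; first by case: Lw.
  (* All edges that [w] emits in [E] are kept, so a bifurcation of [E] at [w] is one of [F]. *)
  apply: card_le_trans bw _; apply: subset_card_le => e [Ee sw].
  rewrite -sw in iw; have [sF _] := kept_edge D Ee iw.
  by split; [exact: edge_desing | rewrite sF].
move=> [q [q0 qE uq]]; have [qF eqs] := path_desing Lw qE.
case: (Lw) => Fw /(_ w (tree_refl Fw))[_]; apply; exists q.
by split=> //; rewrite eqs.
Qed.

End Desingularization.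

Theorem proposition2p1 (V A : choiceType) (E F : graph V A)
  (hF : desingularization E F) :
  line_points E = line_points F `&` vertices E /\
  (line_points E !=set0 <-> line_points F !=set0).
Proof.
case: hF => t [f [l [g D]]]; split.
  apply/seteqP; split=> [u Lu|u []]; last exact: line_points_desing_sub D _.
  by split; [apply: line_points_sub_desing D _ _ | case: Lu].
split=> -[u Lu]; first by exists u; apply: line_points_sub_desing D _ _.
have : vertices F u by case: Lu.
rewrite (desing_vertices D) => -[Eu|[v sv [k _ tu]]].
  by exists u; apply: line_points_desing_sub D _ _ _.
rewrite -tu in Lu; exists v.
case: sv => [/sink_line_point|] //.
by move=> /(line_points_desing_not_infinite_emitter D Lu).
Qed.
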